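(* For every fixed integer $\ell \geq 0$, the problems \textsc{wc-$(0,\ell)$g} and \textsc{wc-$(1,\ell)$g} can be solved in polynomial time.
   Context: All graphs are finite and simple. An $(r,\ell)$-partition of a graph $G$ is a partition of $V(G)$ into $r$ independent sets and $\ell$ cliques (parts may be empty); $G$ is an $(r,\ell)$-graph if it admits one. A graph is well-covered if all its maximal independent sets have the same cardinality. For fixed $r,\ell$, the problem \textsc{wc-$(r,\ell)$g} takes as input an $(r,\ell)$-graph $G$ together with an $(r,\ell)$-partition of $V(G)$ and asks whether $G$ is well-covered. *)

(* Defs.v *)
From mathcomp Require Import all_boot.
Set Implicit Arguments. Unset Strict Implicit. Unset Printing Implicit Defensive.

Definition simple_graph (n : nat) (e : rel 'I_n) : Prop :=
  (forall x y, e x y = e y x) /\ (forall x, ~~ e x x).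

Definition independent (n : nat) (e : rel 'I_n) (A : {set 'I_n}) : bool :=
  [forall x in A, forall y in A, ~~ e x y].

Definition clique (n : nat) (e : rel 'I_n) (A : {set 'I_n}) : bool :=
  [forall x in A, forall y in A, (x != y) ==> e x y].

Definition maximal_independent (n : nat) (e : rel 'I_n) (A : {set 'I_n}) : bool :=
  maxset (independent e) A.

Definition well_covered (n : nat) (e : rel 'I_n) : Prop :=
  forall A B : {set 'I_n}, maximal_independent e A -> maximal_independent e B ->
    #|A| = #|B|.

Definition rl_partition (r l n : nat) (e : rel 'I_n) (p : 'I_n -> 'I_(r + l)) : Prop :=
  forall i : 'I_(r + l),
    if (i < r)%N then independent e [set v | p v == i]
    else clique e [set v | p v == i].

Definition unary (k : nat) : seq bool := rcons (nseq k true) false.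

Definition encode_instance (r l n : nat) (e : rel 'I_n) (p : 'I_n -> 'I_(r + l))
  : seq bool :=
  unary n ++ [seq e i j | i <- enum 'I_n, j <- enum 'I_n]
          ++ flatten [seq unary (p v) | v <- enum 'I_n].

Inductive dir := MoveL | MoveR.

(* States 'I_Q.+1 (start state ord0); tape symbols 'I_S.+3 with blank
   = ord0, and the input letters false / true written as 1 / 2.
   delta = None means the machine halts; tm_acc says whether a halting
   state accepts. *)
Record TM := {
  tm_Q : nat;
  tm_S : nat;
  tm_delta : 'I_tm_Q.+1 -> 'I_tm_S.+3 -> option ('I_tm_Q.+1 * 'I_tm_S.+3 * dir);
  tm_acc : 'I_tm_Q.+1 -> bool
}.

(* configuration: state, left part of tape (reversed, nearest cell first),
   scanned symbol, right part of tape. *)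
Record config (M : TM) := Config {
  cf_state : 'I_(tm_Q M).+1;
  cf_left : seq 'I_(tm_S M).+3;
  cf_head : 'I_(tm_S M).+3;
  cf_right : seq 'I_(tm_S M).+3
}.

Definition blank (M : TM) : 'I_(tm_S M).+3 := ord0.

Definition sym_of_bool (M : TM) (b : bool) : 'I_(tm_S M).+3 :=
  if b then inord 2 else inord 1.

Definition tm_init (M : TM) (w : seq bool) : config M :=
  match map (sym_of_bool M) w with
  | [::] => Config ord0 [::] (blank M) [::]
  | x :: rest => Config ord0 [::] x rest
  end.

Definition halted (M : TM) (c : config M) : bool :=
  if tm_delta (cf_state c) (cf_head c) is None then true else false.

Definition tm_step (M : TM) (c : config M) : config M :=
  match tm_delta (cf_state c) (cf_head c) with
  | None => c
  | Some (q', a, MoveL) =>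
      match cf_left c with
      | [::] => Config q' [::] (blank M) (a :: cf_right c)
      | x :: l => Config q' l x (a :: cf_right c)
      end
  | Some (q', a, MoveR) =>
      match cf_right c with
      | [::] => Config q' (a :: cf_left c) (blank M) [::]
      | x :: rt => Config q' (a :: cf_left c) x rt
      end
  end.

Definition halts_within (M : TM) (w : seq bool) (t : nat) (b : bool) : Prop :=
  exists k, (k <= t)%N /\
    let c := iter k (@tm_step M) (tm_init M w) in
    halted c /\ tm_acc (cf_state c) = b.

Definition wc_rlg_polytime (r l : nat) : Prop :=
  exists (M : TM) (c d : nat),
    forall (n : nat) (e : rel 'I_n) (p : 'I_n -> 'I_(r + l)),
      simple_graph e -> rl_partition e p ->
      exists b : bool,
        halts_within M (encode_instance e p)
          (c * (size (encode_instance e p)).+1 ^ d) b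
        /\ (b = true <-> well_covered e).

(* Main.v *)
Require Import Defs.
From mathcomp Require Import all_boot zify.
From Stdlib Require Import FunctionalExtensionality.
Set Implicit Arguments. Unset Strict Implicit. Unset Printing Implicit Defensive.

(** Let [S] be the independent part (empty if [r = 0]). A maximal independent
    set [I] is determined by its trace [A] on the cliques, which has at most
    one vertex per clique: [I] is [A] together with the vertices of [S] that
    have no neighbour in [A]. So [G] is well-covered iff for some [c] every
    tuple [A] of boundedly many vertices that generates a maximal independent
    set generates one of size [c]. This is a first-order formula with counting
    quantifiers over the positions of the input word, of a size depending only
    on [l]; edges are located by counting pairs of positions. Any such formula
    is evaluated in polynomial time by a Turing machine keeping each variable
    and each counter as a mark on one cell of the input, every elementary
    operation being one sweep over the marked word. *)

(** * Turing machine fragments *)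

Definition upd (T : Type) (f : nat -> T) (x : nat) (v : T) : nat -> T :=
  fun y => if y == x then v else f y.

Lemma upd_id (T : Type) (f : nat -> T) x : upd f x (f x) = f.
Proof. by apply: functional_extensionality => y; rewrite /upd; case: eqP => [->|]. Qed.

(** No left move starts from position [0], so an execution stays on the one-sided tape indexed by
    [nat]. *)
Definition moves (d : dir) (p p' : nat) : bool :=
  if d is MoveR then p' == p.+1 else p == p'.+1.

Section Fragments.
Variable K : nat.

(** An input letter, [None] beyond the end of the word, together with the set of registers whose
    mark lies on the cell. *)
Definition cell := (option bool * {ffun 'I_K.+1 -> bool})%type.

(** A fragment is a subroutine: the target [inr b] leaves it with answer [b], on a transition that
    still writes and moves. *)
Record frag := Frag {
  fstate : finType;
  fstart : fstate;
  fdelta : fstate -> cell -> (fstate + bool) * cell * dir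
}.

Inductive exec (F : frag) : fstate F -> (nat -> cell) -> nat ->
    nat -> bool -> (nat -> cell) -> nat -> Prop :=
| exec_exit q f p b a d p' :
    fdelta q (f p) = (inr b, a, d) -> moves d p p' ->
    exec q f p 1 b (upd f p a) p'
| exec_step q f p q' a d p' k b f'' p'' :
    fdelta q (f p) = (inl q', a, d) -> moves d p p' ->
    exec q' (upd f p a) p' k b f'' p'' -> exec q f p k.+1 b f'' p''.

(** Control structures copy the states of a fragment and redirect only its exits, as told by [cont].
    This one induction serves both [ite] and [while]. *)
Lemma exec_embed (F X : frag) (emb : fstate F -> fstate X)
    (cont : bool -> fstate X + bool) :
  (forall q g, fdelta (emb q) g = let: (o, a, d) := fdelta q g in
     (match o with inl q' => inl (emb q') | inr b => cont b end, a, d)) ->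
  forall q f p k b f' p', exec q f p k b f' p' ->
  match cont b with
  | inl q2 => forall k2 b2 f2 p2,
      exec q2 f' p' k2 b2 f2 p2 -> exec (emb q) f p (k + k2) b2 f2 p2
  | inr b' => exec (emb q) f p k b' f' p'
  end.
Proof.
move=> embE q f p k b f' p'; elim=> {q f p k b f' p'}.
- move=> q f p b a d p' dq mv; have := embE q (f p); rewrite dq.
  case: (cont b) => [q2|b'] eq2; last exact: exec_exit eq2 mv.
  by move=> k2 b2 f2 p2; apply: exec_step eq2 mv.
- move=> q f p q' a d p' k b f'' p'' dq mv _; have := embE q (f p); rewrite dq.
  case: (cont b) => [q2|b'] eq2 IH; last exact: exec_step eq2 mv IH.
  by move=> k2 b2 f2 p2 /IH; apply: exec_step eq2 mv.
Qed.

Definition ite (F G H : frag) : frag :=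
  @Frag (fstate F + (fstate G + fstate H))%type (inl (fstart F))
    (fun q g => match q with
     | inl q => let: (o, a, d) := fdelta q g in
         (match o with
          | inl q' => inl (inl q')
          | inr b => inl (inr (if b then inl (fstart G) else inr (fstart H)))
          end, a, d)
     | inr (inl q) => let: (o, a, d) := fdelta q g in
         (match o with inl q' => inl (inr (inl q')) | inr b => inr b end, a, d)
     | inr (inr q) => let: (o, a, d) := fdelta q g in
         (match o with inl q' => inl (inr (inr q')) | inr b => inr b end, a, d)
     end).

Definition while (F G : frag) : frag :=
  @Frag (fstate F + fstate G)%type (inl (fstart F))
    (fun q g => match q with
     | inl q => let: (o, a, d) := fdelta q g in
         (match o with
          | inl q' => inl (inl q')
          | inr b => if b then inl (inr (fstart G)) else inr true
          end, a, d)
     | inr q => let: (o, a, d) := fdelta q g in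
         (match o with
          | inl q' => inl (inr q')
          | inr b => inl (inl (fstart F))
          end, a, d)
     end).

Definition runs (F : frag) f p k b f' p' := exec (fstart F) f p k b f' p'.

Lemma runs_ite F G H f p k b f' p' k2 b2 f2 p2 :
  runs F f p k b f' p' -> runs (if b then G else H) f' p' k2 b2 f2 p2 ->
  runs (ite F G H) f p (k + k2) b2 f2 p2.
Proof.
move=> rF r2; have := @exec_embed F (ite F G H) inl
  (fun b => inl (inr (if b then inl (fstart G) else inr (fstart H)))) _ _ _ _ _ _ _ _ rF.
apply=> //; case: {rF} b r2 => r2.
- by apply: (@exec_embed G (ite F G H) (fun q => inr (inl q)) inr _ _ _ _ _ _ _ _ r2).
- by apply: (@exec_embed H (ite F G H) (fun q => inr (inr q)) inr _ _ _ _ _ _ _ _ r2).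
Qed.

Lemma runs_while_exit F G f p k f' p' :
  runs F f p k false f' p' -> runs (while F G) f p k true f' p'.
Proof.
move=> rF; exact: (@exec_embed F (while F G) inl
  (fun b => if b then inl (inr (fstart G)) else inr true) _ _ _ _ _ _ _ _ rF).
Qed.

Lemma runs_while_loop F G f p k f' p' k2 b2 f2 p2 k3 b3 f3 p3 :
  runs F f p k true f' p' -> runs G f' p' k2 b2 f2 p2 ->
  runs (while F G) f2 p2 k3 b3 f3 p3 ->
  runs (while F G) f p (k + (k2 + k3)) b3 f3 p3.
Proof.
move=> rF rG rW; have := @exec_embed F (while F G) inl
  (fun b => if b then inl (inr (fstart G)) else inr true) _ _ _ _ _ _ _ _ rF.
apply=> //; have := @exec_embed G (while F G) inr
  (fun b => inl (inl (fstart F))) _ _ _ _ _ _ _ _ rG.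
exact.
Qed.

(** * One sweep over the marked word, to its end and back *)

Section Sweep.
Variables (b0 : bool) (u : bool -> cell -> bool * {ffun 'I_K.+1 -> bool}).

(* Phases: [None] moves right applying [u], up to the first cell without a
   letter; [Some false] moves left to the cell carrying mark [ord0];
   [Some true] only compensates the obligatory move away from that cell. *)
Definition sweep : frag :=
  @Frag (bool * option bool)%type (b0, None)
    (fun q g => match q with
     | (b, None) =>
         let: (b', M) := u b g in
         if g.1 is None then (inl (b', Some false), (g.1, M), MoveL)
         else (inl (b', None), (g.1, M), MoveR)
     | (b, Some false) =>
         if g.2 ord0 then (inl (b, Some true), g, MoveR)
         else (inl (b, Some false), g, MoveL)
     | (b, Some true) => (inr b, g, MoveL)
     end).

Fixpoint sweep_acc (f : nat -> cell) (i : nat) : bool :=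
  if i is i'.+1 then (u (sweep_acc f i') (f i')).1 else b0.

Lemma sweep_return (f : nat -> cell) b N p : p <= N ->
  (forall i, i <= N -> (f i).2 ord0 = (i == 0)) ->
  @exec sweep (b, Some false) f p p.+2 b f 0.
Proof.
move=> pN f0; elim: p pN => [|p IH] pN.
- apply: (@exec_step sweep _ _ _ (b, Some true) (f 0) MoveR 1); rewrite //=.
    by rewrite f0.
  rewrite upd_id -{2}(upd_id f 1); exact: (@exec_exit sweep _ _ _ b (f 1) MoveL).
- apply: (@exec_step sweep _ _ _ (b, Some false) (f p.+1) MoveL p); rewrite //=.
    by rewrite f0.
  by rewrite upd_id; apply/IH/ltnW.
Qed.

Lemma runs_sweep (N : nat) (f f' : nat -> cell) : 0 < N ->
  (forall i, i < N -> (f i).1) -> (f N).1 = None ->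
  (forall i, i <= N -> f' i = ((f i).1, (u (sweep_acc f i) (f i)).2)) ->
  (forall i, N < i -> f' i = f i) ->
  (forall i, i <= N -> (f' i).2 ord0 = (i == 0)) ->
  runs sweep f 0 (N.+1).*2 (sweep_acc f N.+1) f' 0.
Proof.
move=> N0 fS fN f'E f'N f'0.
(* [mid i] is the tape at the moment when the head, moving right, reaches cell [i]. *)
pose mid i j := if j < i then f' j else f j.
have midS i : i <= N -> upd (mid i) i ((f i).1, (u (sweep_acc f i) (f i)).2) = mid i.+1.
  move=> iN; apply: functional_extensionality => j; rewrite /upd /mid ltnS.
  by case: eqP => [->|ne]; [rewrite leqnn f'E | case: ltngtP ne].
have midi i : mid i i = f i by rewrite /mid ltnn.
have midN : mid N.+1 = f'.
  apply: functional_extensionality => j; rewrite /mid ltnS.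
  by case: leqP => // /f'N.
suff H d i : i + d = N ->
    @exec sweep (sweep_acc f i, None) (mid i) i (d + N.+2) (sweep_acc f N.+1) f' 0.
  have := H N 0 erefl; rewrite (_ : mid 0 = f) //.
  by rewrite (_ : N + N.+2 = (N.+1).*2) // ; lia.
elim: d i => [|d IH] i iN.
- rewrite addn0 in iN; subst i.
  (* The head turns at cell [N] by a move to the left, which is possible as [N] is positive. *)
  case: N N0 fS fN f'E f'N f'0 midS midN => // p _ _ fN _ _ f'0 midS midN.
  apply: (@exec_step sweep _ _ _ (sweep_acc f p.+2, Some false)
    ((f p.+1).1, (u (sweep_acc f p.+1) (f p.+1)).2) MoveL p); rewrite //=.
    by rewrite midi; case: (u _ _) => b' M /=; rewrite fN.
  rewrite midS // midN; apply: sweep_return f'0; exact: leqnSn.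
- apply: (@exec_step sweep _ _ _ (sweep_acc f i.+1, None)
    ((f i).1, (u (sweep_acc f i) (f i)).2) MoveR i.+1); rewrite //=.
    have {fS}: (f i).1 by apply: fS; lia.
    by rewrite midi; case: (u _ _) => b' M /=; case: (f i).1.
  rewrite midS; [by apply: (IH i.+1); rewrite addSnnS | lia].
Qed.
End Sweep.

(** * Registers stored as marks, and the elementary operations on them *)

Section Registers.
Variable w : seq bool.
Let N := size w.
Hypothesis N_gt0 : 0 < N.

Definition tape (s : nat -> nat) (i : nat) : cell :=
  (onth w i, [ffun x : 'I_K.+1 => s x == i]).

(** The mark of register [0] is how a sweep recognises the left end of the tape. *)
Definition valid (s : nat -> nat) := s 0 = 0 /\ forall x, s x <= N.

Definition ends F s k b s' := runs F (tape s) 0 k b (tape s') 0.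

Lemma onthN : onth w N = None.
Proof. exact: onth_default. Qed.

Lemma onth_some i : i < N -> onth w i.
Proof. by rewrite -onthTE. Qed.

Lemma ends_sweep b0 u s s' : valid s -> valid s' ->
  (forall i, i <= N -> (u (sweep_acc b0 u (tape s) i) (tape s i)).2 = (tape s' i).2) ->
  ends (sweep b0 u) s (N.+1).*2 (sweep_acc b0 u (tape s) N.+1) s'.
Proof.
move=> [s0 sN] [s'0 s'N] uE; apply: runs_sweep => //.
- exact: onth_some.
- exact: onthN.
- by move=> i iN; rewrite uE.
- move=> i iN; congr pair; apply/ffunP=> x; rewrite !ffunE.
  by have := sN x; have := s'N x; lia.
- by move=> i iN; rewrite ffunE s'0 eq_sym.
Qed.

Definition mark (y : nat) (g : cell) := g.2 (inord y).

Lemma mark_tape y s i : y <= K -> mark y (tape s i) = (s y == i).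
Proof. by move=> yK; rewrite /mark ffunE inordK. Qed.

Definition set_mark (y : nat) (v : bool) (g : cell) : {ffun 'I_K.+1 -> bool} :=
  [ffun x : 'I_K.+1 => if (x : nat) == y then v else g.2 x].

Definition copy (y x : nat) := sweep true (fun b g => (b, set_mark y (mark x g) g)).

(** The bit remembers that the previous cell carried the mark, which is thus shifted by one cell. On
    the blank cell [N] a mark already present is kept, so the register saturates. *)
Definition inc (y : nat) := sweep false (fun b g =>
  if g.1 is None then (true, set_mark y (mark y g || b) g)
  else (mark y g, set_mark y b g)).

(** The bit tells whether the last mark met is that of [y]. On a common cell [x] wins, which makes
    the comparison strict. *)
Definition less (x y : nat) := sweep false (fun b g =>
  (if mark x g then false else mark y g || b, g.2)).

Definition test (P : cell -> bool) (x : nat) := sweep false (fun b g =>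
  (b || (mark x g && P g), g.2)).

Definition const (b : bool) := sweep b (fun b g => (b, g.2)).

Lemma valid_upd s y v : valid s -> 0 < y -> v <= N -> valid (upd s y v).
Proof.
move=> [s0 sN] y0 vN; split; first by rewrite /upd; case: eqP => // y0'; lia.
by move=> x; rewrite /upd; case: eqP.
Qed.

Lemma ends_copy s y x : valid s -> x <= K -> 0 < y ->
  ends (copy y x) s (N.+1).*2 true (upd s y (s x)).
Proof.
move=> vs xK y0; rewrite /copy; set u := (X in sweep _ X).
have accE i : sweep_acc true u (tape s) i = true by elim: i.
rewrite -{2}(accE N.+1); apply: ends_sweep => //.
  by apply: valid_upd => //; apply: vs.2.
move=> i iN; apply/ffunP=> z; rewrite /= !ffunE mark_tape //.
by rewrite /upd; case: eqP.
Qed.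

Lemma ends_inc s y : valid s -> 0 < y <= K ->
  ends (inc y) s (N.+1).*2 true (upd s y (minn N (s y).+1)).
Proof.
move=> vs /andP[y0 yK]; rewrite /inc; set u := (X in sweep _ X).
have accE i : i <= N -> sweep_acc false u (tape s) i = ((s y).+1 == i).
  elim: i => [|i IH] // iN /=; rewrite IH; last exact: ltnW.
  by rewrite /u; have := onth_some iN; rewrite /=; case: onth => // c _; rewrite mark_tape.
have <- : sweep_acc false u (tape s) N.+1 = true by rewrite /= {1}/u /= onthN.
apply: ends_sweep => //; first by apply: valid_upd => //; apply: geq_minl.
move=> i iN; rewrite accE //; apply/ffunP=> z; rewrite /u.
have := vs.2 y; rewrite leq_eqVlt in iN; case/orP: iN => [/eqP->|iN].
- rewrite /= onthN /= !ffunE mark_tape // /upd; case: eqP => // _; lia.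
- have := onth_some iN; rewrite /=; case: onth => // c _; rewrite !ffunE /upd.
  by case: eqP => // _; lia.
Qed.

Lemma ends_less s x y : valid s -> x <= K -> y <= K ->
  ends (less x y) s (N.+1).*2 (s x < s y) s.
Proof.
move=> vs xK yK; rewrite /less; set u := (X in sweep _ X).
have accE i : sweep_acc false u (tape s) i = (s y < i) && ((s x < s y) || (i <= s x)).
  by elim: i => [|i IH] //=; rewrite IH !mark_tape //; case: (s x =P i); lia.
rewrite (_ : (s x < s y) = sweep_acc false u (tape s) N.+1); first exact: ends_sweep.
by rewrite accE; have := vs.2 x; have := vs.2 y; lia.
Qed.

Lemma ends_test s P x : valid s -> x <= K ->
  ends (test P x) s (N.+1).*2 (P (tape s (s x))) s.
Proof.
move=> vs xK; rewrite /test; set u := (X in sweep _ X).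
have accE i : sweep_acc false u (tape s) i = (s x < i) && P (tape s (s x)).
  elim: i => [|i IH] //=; rewrite IH !mark_tape // ltnS.
  by case: ltngtP => [||<-] //=; rewrite orbF.
rewrite (_ : P _ = sweep_acc false u (tape s) N.+1); first exact: ends_sweep.
by rewrite accE ltnS vs.2.
Qed.

Lemma ends_const s b : valid s -> ends (const b) s (N.+1).*2 b s.
Proof.
move=> vs; rewrite /const; set u := (X in sweep _ X).
have accE i : sweep_acc b u (tape s) i = b by elim: i.
by rewrite -{2}(accE N.+1); apply: ends_sweep.
Qed.

Definition seqf F G := ite F G G.

Lemma ends_seq F G s k b s' k2 b2 s2 : ends F s k b s' -> ends G s' k2 b2 s2 ->
  ends (seqf F G) s (k + k2) b2 s2.
Proof. by move=> rF rG; apply: runs_ite rF _; case: b. Qed.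

Definition has_letter (g : cell) : bool := g.1.

(** Register [x] runs through the positions of the word; the loop stops when its mark arrives at the
    blank cell [N]. *)
Definition loop (x : nat) (body : frag) :=
  seqf (copy x 0) (while (test has_letter x) (seqf body (inc x))).

Lemma ends_loop x body (B : nat) (J : nat -> (nat -> nat) -> Prop) s :
  0 < x <= K -> valid s -> J 0 (upd s x 0) ->
  (forall a t, a < N -> valid t -> t x = a -> J a t -> exists k b t',
     [/\ k <= B, ends body t k b t', valid t', t' x = a & J a.+1 (upd t' x a.+1)]) ->
  exists k s', [/\ k <= N.+1 * (B + 6 * N.+1), ends (loop x body) s k true s',
     valid s' & J N s'].
Proof.
move=> /andP[x0 xK] vs J0 Jstep.
(* Induction on the number [d] of rounds left, with [J a] as invariant on entry to round [a]. *)
suff W d a t : a + d = N -> valid t -> t x = a -> J a t -> exists k s',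
    [/\ k <= d * (B + 4 * N.+1) + (N.+1).*2,
        ends (while (test has_letter x) (seqf body (inc x))) t k true s',
        valid s' & J N s'].
  have r1 := ends_copy vs (leq0n K) x0; rewrite vs.1 in r1.
  have [||k [s' [kB r2 vs' JN]]] := W N 0 (upd s x 0) erefl _ _ J0.
  - exact: valid_upd.
  - by rewrite /upd eqxx.
  exists ((N.+1).*2 + k), s'; split=> //; first by nia.
  exact: ends_seq r1 r2.
elim: d a t => [|d IH] a t aN vt tx Ja.
- have r := ends_test has_letter vt xK.
  have aN' : a = N by lia.
  rewrite tx aN' /has_letter /= onthN in r.
  exists (N.+1).*2, t; split=> //; last by rewrite -aN'.
  exact: runs_while_exit r.
- have lt_aN : a < N by lia.
  have r := ends_test has_letter vt xK.
  rewrite tx /has_letter /= onth_some // in r.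
  have [k [b [t' [kB rb vt' t'x Ja']]]] := Jstep a t lt_aN vt tx Ja.
  have ri : ends (inc x) t' (N.+1).*2 true (upd t' x a.+1).
    by have := ends_inc vt' (y := x); rewrite t'x x0 xK (minn_idPr lt_aN); apply.
  have [|||k3 [s' [k3B rw vs' JN]]] := IH a.+1 (upd t' x a.+1) _ _ _ Ja'.
  - lia.
  - exact: valid_upd.
  - by rewrite /upd eqxx.
  exists ((N.+1).*2 + (k + (N.+1).*2 + k3)), s'; split=> //; first by nia.
  exact: runs_while_loop r (ends_seq rb ri) rw.
Qed.

End Registers.
End Fragments.

(** * Formulas with counting and their compilation *)

(* Variables are de Bruijn indices denoting positions of the input word.
   [Count k phi o] compares the number of [k.+1]-tuples satisfying [phi] with
   the value of a variable, or with [0] when [o] is [None]. *)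
Inductive form :=
| Less of nat & nat
| Letter of nat
| Not of form
| And of form & form
| Count of nat & form & option nat.

Fixpoint count_tuples (N k : nat) (P : seq nat -> bool) (env : seq nat) : nat :=
  if k is k'.+1 then \sum_(a < N) count_tuples N k' P (val a :: env) else P env.

Definition value (env : seq nat) (o : option nat) := oapp (nth 0 env) 0 o.

(* Counters saturate at the length of the word. *)
Fixpoint sem (w : seq bool) (phi : form) (env : seq nat) : bool :=
  match phi with
  | Less x y => nth 0 env x < nth 0 env y
  | Letter x => onth w (nth 0 env x) == Some true
  | Not phi => ~~ sem w phi env
  | And phi psi => sem w phi env && sem w psi env
  | Count k phi o =>
      minn (size w) (count_tuples (size w) k.+1 (sem w phi) env) == value env o
  end.

(* With [m] variables in scope, variable [j] lives in register [2 * (m - j)];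
   register [0] constantly holds [0] and odd registers hold counters. *)
Definition var_reg (m j : nat) := 2 * (m - j).

Section Compile.
Variable K : nat.

Fixpoint adder (c k m : nat) (body : nat -> frag K) : frag K :=
  if k is k'.+1 then loop (2 * m.+1) (adder c k' m.+1 body)
  else ite (body m) (inc K c) (const K true).

Fixpoint compile (phi : form) (m : nat) : frag K :=
  match phi with
  | Less x y => less K (var_reg m x) (var_reg m y)
  | Letter x => test (fun g => g.1 == Some true) (var_reg m x)
  | Not phi => ite (compile phi m) (const K false) (const K true)
  | And phi psi => ite (compile phi m) (compile psi m) (const K false)
  | Count k phi o =>
      let c := (2 * m).+1 in
      seqf (copy K c 0) (seqf (adder c k.+1 m (compile phi))
        (test (mark c) (oapp (var_reg m) 0 o)))
  end.
End Compile.

(** The counter [(2 * m).+1] of a [Count] lies below the register of its innermost variable, so only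
    even registers are listed. *)
Fixpoint max_reg (phi : form) (m : nat) : nat :=
  match phi with
  | Less x y => maxn (var_reg m x) (var_reg m y)
  | Letter x => var_reg m x
  | Not phi => max_reg phi m
  | And phi psi => maxn (max_reg phi m) (max_reg psi m)
  | Count k phi o => maxn (2 * (m + k.+1)) (max_reg phi (m + k.+1))
  end.

Fixpoint adder_cost (N k B : nat) : nat :=
  if k is k'.+1 then N.+1 * (adder_cost N k' B + 6 * N.+1) else B + (N.+1).*2.

Fixpoint cost (N : nat) (phi : form) : nat :=
  match phi with
  | Less _ _ | Letter _ => (N.+1).*2
  | Not phi => cost N phi + (N.+1).*2
  | And phi psi => cost N phi + cost N psi + (N.+1).*2
  | Count k phi _ => adder_cost N k.+1 (cost N phi) + 4 * N.+1
  end.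

(** * Polynomial bounds on the running time *)

Definition polyb (f : nat -> nat) := exists c d, forall N, f N <= c * N.+1 ^ d.

Lemma polyb_const c : polyb (fun _ => c).
Proof. by exists c, 0 => N; rewrite expn0 muln1. Qed.

Lemma polyb_succ : polyb S.
Proof. by exists 1, 1 => N; rewrite mul1n expn1. Qed.

Lemma polyb_mul f g : polyb f -> polyb g -> polyb (fun N => f N * g N).
Proof.
move=> [c [d fP]] [c' [d' gP]]; exists (c * c'), (d + d') => N.
by rewrite expnD mulnACA leq_mul.
Qed.

Lemma polyb_add f g : polyb f -> polyb g -> polyb (fun N => f N + g N).
Proof.
move=> [c [d fP]] [c' [d' gP]]; exists (c + c'), (d + d') => N.
rewrite mulnDl leq_add // ?(leq_trans (fP N)) ?(leq_trans (gP N)) // leq_mul //.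
  by rewrite leq_pexp2l // leq_addr.
by rewrite leq_pexp2l // leq_addl.
Qed.

Lemma polyb_double f : polyb f -> polyb (fun N => (f N).*2).
Proof.
move=> /(polyb_mul (polyb_const 2)) [c [d fP]]; exists c, d => N.
by rewrite -mul2n fP.
Qed.

(** Each bound variable contributes one factor [N.+1], so the degree depends on the formula
    alone. *)
Lemma polyb_cost phi : polyb (cost ^~ phi).
Proof.
have sw : polyb (fun N => (N.+1).*2) by apply/polyb_double/polyb_succ.
have lin c : polyb (fun N => c * N.+1).
  by apply: polyb_mul; [apply: polyb_const | apply: polyb_succ].
have add k B : polyb B -> polyb (fun N => adder_cost N k (B N)).
  move=> pB; elim: k => [|k IH] /=; first exact: polyb_add.
  by apply: polyb_mul; [apply: polyb_succ | apply: polyb_add].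
elim: phi => [x y|x|phi IH|phi IH psi IH'|k phi IH o] //=.
- exact: polyb_add.
- by apply: polyb_add => //; apply: polyb_add.
- by apply: polyb_add => //; apply: (add k.+1).
Qed.

(** * Correctness of the compilation *)

Fixpoint env_of (s : nat -> nat) (m : nat) : seq nat :=
  if m is m'.+1 then s (2 * m) :: env_of s m' else [::].

(** For an index out of scope, truncated subtraction selects register [0], whose value agrees with
    the default of [nth]. *)
Lemma nth_env_of s m j : s 0 = 0 -> nth 0 (env_of s m) j = s (var_reg m j).
Proof.
rewrite /var_reg => s0; elim: m j => [|m IH] [|j] /=; rewrite ?sub0n ?muln0 ?subn0 ?subSS //.
Qed.

Lemma eq_env_of s s' m : (forall j, j <= m -> s (2 * j) = s' (2 * j)) ->
  env_of s m = env_of s' m.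
Proof.
elim: m => [|m IH] //= ss'; congr cons; first exact: ss'.
by apply: IH => j jm; apply: ss'; lia.
Qed.

Section Correct.
Variables (w : seq bool) (K : nat).
Let N := size w.
Hypothesis N_gt0 : 0 < N.

(** The counter is an odd register and the loop variables are even ones, so running the loops does
    not disturb it. *)
Lemma ends_adder (c k m0 B : nat) (body : nat -> frag K) (P : seq nat -> bool) :
  let top := m0 + k in
  odd c -> c <= (2 * m0).+1 -> 0 < k -> 2 * top <= K ->
  (forall s, valid w s -> exists t s', [/\ t <= B,
     ends w (body top) s t (P (env_of s top)) s', valid w s' &
     forall y, y <= 2 * top -> s' y = s y]) ->
  forall s, valid w s -> exists t s', [/\ t <= adder_cost N k B,
     ends w (adder c k m0 body) s t true s', valid w s',
     s' c = minn N (s c + count_tuples N k P (env_of s m0)) &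
     forall y, y <= 2 * m0 -> y != c -> s' y = s y].
Proof.
move=> top oc cm0 k0 topK bodyP.
(* Generalised to [j] loops left at depth [m]. The body preserves the registers up to [2 * top],
   which must include the counter once [j] is [0]. *)
suff H j m : m + j = top -> m0 <= m -> (j == 0) || (c <= (2 * m).+1) -> (j == 0) ==> (c <= 2 * m) ->
    forall s, valid w s -> exists t s', [/\ t <= adder_cost N j B,
     ends w (adder c j m body) s t true s', valid w s',
     s' c = minn N (s c + count_tuples N j P (env_of s m)) &
     forall y, y <= 2 * m -> y != c -> s' y = s y].
  by apply: H => //; [rewrite cm0 orbT | case: (k) k0].
elim: j m => [|j IH] m mj m0m cm cm' s vs.
- rewrite addn0 in mj; subst m; have [t [s' [tB r1 vs' s's]]] := bodyP s vs.
  have s'c : s' c = s c by apply: s's.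
  rewrite /= in r1 *; case Pe: (P _) r1 => r1.
  + exists (t + (N.+1).*2), (upd s' c (minn N (s' c).+1)); split=> //.
    * by rewrite leq_add2r.
    * apply: runs_ite r1 _; apply: ends_inc => //; lia.
    * by apply: valid_upd; rewrite ?geq_minl //; lia.
    * by rewrite /upd eqxx s'c addn1.
    * by move=> y yt yc; rewrite /upd (negPf yc) s's.
  + exists (t + (N.+1).*2), s'; split=> //.
    * by rewrite leq_add2r.
    * by apply: runs_ite r1 _; apply: ends_const.
    * by rewrite s'c addn0; have := vs.2 c; rewrite -/N; lia.
    * by move=> y yt _; rewrite s's.
- rewrite /= in cm *.
  set x := 2 * m.+1; set A := adder c j m.+1 body.
  (* Invariant: the counter holds the saturated partial sum over the values below [a] of the loop
     variable. *)
  pose J a (s' : nat -> nat) :=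
    s' c = minn N (s c + \sum_(0 <= i < a) count_tuples N j P (i :: env_of s m)) /\
    forall y, y <= 2 * m -> y != c -> s' y = s y.
  have xc : x != c by apply: contraTneq oc => <-; rewrite /x mul2n odd_double.
  have [|||t [s' [tB r vs' [s'c s's]]]] := @ends_loop K w N_gt0 x A (adder_cost N j B) J s _ vs.
  + by rewrite /x; lia.
  + split; first by rewrite big_nil addn0 /upd eq_sym (negPf xc); have := vs.2 c; rewrite -/N; lia.
    by move=> y ym yc; rewrite /upd; case: eqP => // yx; rewrite yx /x in ym; lia.
  + move=> a s1 aN vs1 s1x [s1c s1s].
    have [||||t [s2 [tB r vs2 s2c s2s]]] := IH m.+1 _ _ _ _ s1 vs1.
    * by rewrite -mj addnS.
    * lia.
    * by apply/orP; right; lia.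
    * by apply/implyP; lia.
    exists t, true, s2; split=> //.
      by rewrite s2s // s1x.
    split.
      rewrite /upd eq_sym (negPf xc) s2c s1c big_nat_recr //= -/x s1x.
      rewrite (@eq_env_of s1 s); first lia.
      move=> i im; apply: s1s; first by lia.
      by apply: contraTneq oc => <-; rewrite mul2n odd_double.
    move=> y ym yc; rewrite /upd; case: eqP => [yx|_]; first by rewrite yx /x in ym; lia.
    by rewrite s2s // ?s1s //; lia.
  exists t, s'; split=> //.
  by rewrite s'c big_mkord.
Qed.

(** Restoring the registers up to [2 * m] lets a second subformula run in the same environment as
    the first. *)
Lemma ends_compile phi m s : max_reg phi m <= K -> valid w s ->
  exists t s', [/\ t <= cost N phi,
     ends w (compile K phi m) s t (sem w phi (env_of s m)) s', valid w s' &
     forall y, y <= 2 * m -> s' y = s y].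
Proof.
elim: phi m s => [x y|x|phi IH|phi IH psi IH'|k phi IH o] m s /= mK vs.
- exists (N.+1).*2, s; split=> //; rewrite !nth_env_of ?vs.1 //.
  by apply: ends_less => //; lia.
- exists (N.+1).*2, s; split=> //; rewrite !nth_env_of ?vs.1 //.
  by apply: (@ends_test K w N_gt0 s (fun g => g.1 == Some true)) => //; lia.
- have [t [s' [tB r vs' s's]]] := IH m s mK vs.
  exists (t + (N.+1).*2), s'; split=> //; first by rewrite leq_add2r.
  by apply: runs_ite r _; case: sem; apply: ends_const.
- have [t [s' [tB r vs' s's]]] := IH m s ltac:(lia) vs.
  case Pe: (sem w phi _) r => r /=.
    have [t2 [s2 [t2B r2 vs2 s2s]]] := IH' m s' ltac:(lia) vs'.
    exists (t + t2), s2; split=> //; first by lia.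
      apply: runs_ite r _; rewrite (@eq_env_of s s') // => j jm.
      by rewrite s's; lia.
    by move=> y ym; rewrite s2s // s's.
  exists (t + (N.+1).*2), s'; split=> //; first by lia.
  by apply: runs_ite r _; apply: ends_const.
- set c := (2 * m).+1.
  have r1 : ends w (copy K c 0) s (N.+1).*2 true (upd s c 0).
    by have := ends_copy N_gt0 vs (leq0n K) (y := c) isT; rewrite vs.1.
  have vs1 : valid w (upd s c 0) by apply: valid_upd.
  have [|||||t [s2 [tB r2 vs2 s2c s2s]]] := @ends_adder c k.+1 m (cost N phi)
    (compile K phi) (sem w phi) _ _ _ _ _ _ vs1 => //.
  + by rewrite /c mul2n /= odd_double.
  + by lia.
  + by move=> s1 vs1'; apply: IH => //; lia.
  have er : env_of (upd s c 0) m = env_of s m.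
    by apply: eq_env_of => j jm; rewrite /upd /c; case: eqP => //; lia.
  have s2s' y : y <= 2 * m -> s2 y = s y.
    move=> ym; have yc : y != c by rewrite /c; lia.
    by rewrite s2s // /upd (negPf yc).
  set v := oapp (var_reg m) 0 o.
  have vm : v <= 2 * m by rewrite /v /var_reg; case: (o) => //= j; lia.
  (* Equality of the counter with [v] is tested by looking for the mark of [c] on the cell marked by
     [v]; for [None], [v] is register [0]. *)
  have r3 := ends_test N_gt0 (mark c) vs2 (x := v).
  exists ((N.+1).*2 + (t + (N.+1).*2)), s2; split=> //; first by rewrite /= in tB; lia.
  apply: ends_seq r1 (ends_seq r2 _).
  have -> : value (env_of s m) o = s2 v.
    rewrite /value /v; case: o {v vm mK r3} => [j|] /=; last by rewrite vs2.1.
    rewrite nth_env_of ?vs.1 // s2s' //; rewrite /var_reg; lia.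
  have -> : minn (size w) (\sum_(a < size w)
      count_tuples (size w) k (sem w phi) (val a :: env_of s m)) = s2 c.
    by rewrite s2c er /upd eqxx.
  rewrite -(@mark_tape K w c); [by apply: r3; lia | by rewrite /c; lia].
Qed.

End Correct.

(** * Realisation by a machine *)

Section Realize.
Variables (K : nat) (F : frag K).
Let stateF := (fstate F + bool)%type.

Definition no_marks : {ffun 'I_K.+1 -> bool} := [ffun _ => false].

(* The raw symbols 0, 1, 2 stand for unmarked cells. *)
Definition decode_sym (a : 'I_#|{: cell K}|.+3) : cell K :=
  match split (a : 'I_(3 + #|{: cell K}|)) with
  | inl j => (if val j is j'.+1 then Some (j' == 1) else None, no_marks)
  | inr j => enum_val j
  end.

Definition encode_sym (g : cell K) : 'I_#|{: cell K}|.+3 := rshift 3 (enum_rank g).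

Lemma encode_symK : cancel encode_sym decode_sym.
Proof.
move=> g; rewrite /decode_sym /encode_sym.
by have -> := @unsplitK 3 _ (inr (enum_rank g)); rewrite enum_rankK.
Qed.

(** A machine has to start in [ord0], so this state serves as a second name of [fstart F]. *)
Definition decode_state (q : 'I_#|{: stateF}|.+1) : stateF :=
  if unlift ord0 q is Some j then enum_val j else inl (fstart F).

Definition encode_state (q : stateF) : 'I_#|{: stateF}|.+1 := lift ord0 (enum_rank q).

Lemma encode_stateK : cancel encode_state decode_state.
Proof. by move=> q; rewrite /decode_state /encode_state liftK enum_rankK. Qed.

Definition machine : TM := {|
  tm_Q := #|{: stateF}|;
  tm_S := #|{: cell K}|;
  tm_delta := fun q a =>
    if decode_state q is inl q' then
      let: (o, g, d) := fdelta q' (decode_sym a) in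
      Some (encode_state o, encode_sym g, d)
    else None;
  tm_acc := fun q => decode_state q == inr true |}.

(** The left list must be exact, since its length is the head position; the right list matters only
    up to trailing blanks. *)
Definition represents (c : config machine) (q : stateF) (f : nat -> cell K) (p : nat) :=
  [/\ decode_state (cf_state c) = q,
      map decode_sym (cf_left c) = rev (mkseq f p),
      decode_sym (cf_head c) = f p &
      forall i, nth (None, no_marks) (map decode_sym (cf_right c)) i = f (p.+1 + i)].

Lemma decode_blank : decode_sym (blank machine) = (None, no_marks).
Proof.
by rewrite /decode_sym /blank; case: splitP => j /= jE; rewrite -?jE //; move: jE; lia.
Qed.

Lemma decode_sym_of_bool b : decode_sym (sym_of_bool machine b) = (Some b, no_marks).
Proof.
by rewrite /decode_sym /sym_of_bool; case: b; case: splitP => j; rewrite inordK //= => <-.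
Qed.

Lemma rev_mkseqS (f : nat -> cell K) p : rev (mkseq f p.+1) = f p :: rev (mkseq f p).
Proof. by rewrite mkseqS rev_rcons. Qed.

Lemma mkseq_upd (f : nat -> cell K) p p' v : p <= p' -> mkseq (upd f p' v) p = mkseq f p.
Proof.
move=> pp'; apply/eq_in_map => i; rewrite mem_iota /upd => /andP[_ ip].
by case: eqP => // ip'; lia.
Qed.

Lemma represents_step c (q : fstate F) f p o a d p' :
  represents c (inl q) f p -> fdelta q (f p) = (o, a, d) -> moves d p p' ->
  represents (tm_step c) o (upd f p a) p'.
Proof.
case: c => st l h r [/= stE lE hE rE] dq; rewrite /tm_step /= stE hE dq.
have updp : upd f p a p = a by rewrite /upd eqxx.
have updN i : i != p -> upd f p a i = f i by move=> ip; rewrite /upd (negPf ip).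
case: d {dq} => /= /eqP pE.
- subst p; rewrite rev_mkseqS in lE; case: l lE => [//|x l] [xE lE].
  split=> /=; rewrite ?encode_stateK //.
  + by rewrite lE mkseq_upd.
  + by rewrite xE updN //; lia.
  + case=> [|i] /=; first by rewrite encode_symK addn0 updp.
    by rewrite rE addSnnS updN //; lia.
- subst p'; have lE' : map decode_sym (encode_sym a :: l) = rev (mkseq (upd f p a) p.+1).
    by rewrite rev_mkseqS mkseq_upd // updp /= encode_symK lE.
  case: r rE => [|x r] rE; split=> //=; rewrite ?encode_stateK //.
  + by rewrite decode_blank; have := rE 0; rewrite /= addn0 => ->; rewrite updN //; lia.
  + by move=> i; rewrite nth_nil; have := rE i.+1; rewrite /= addnS => ->; rewrite updN //; lia.
  + by have := rE 0; rewrite /= addn0 => ->; rewrite updN //; lia.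
  + by move=> i; have := rE i.+1; rewrite /= addnS => ->; rewrite updN //; lia.
Qed.

Lemma represents_exec q f p k b f' p' c :
  exec q f p k b f' p' -> represents c (inl q) f p ->
  represents (iter k (@tm_step machine) c) (inr b) f' p'.
Proof.
move=> ex; elim: ex c => {q f p k b f' p'}.
- by move=> q f p b a d p' dq mv c cr; apply: represents_step cr dq mv.
- move=> q f p q' a d p' k b f'' p'' dq mv _ IH c cr.
  by rewrite iterSr; apply: IH; apply: represents_step cr dq mv.
Qed.

Lemma represents_init w : 0 < size w ->
  represents (tm_init machine w) (inl (fstart F)) (fun i => (onth w i, no_marks)) 0.
Proof.
case: w => // b w _; rewrite /tm_init /=; split=> //=.
- by rewrite /decode_state unlift_none.
- exact: decode_sym_of_bool.
- elim: w => [|b' w IH] [|i] //=.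
  exact: decode_sym_of_bool.
Qed.

Lemma machine_halts w t b f' p' : 0 < size w ->
  runs F (fun i => (onth w i, no_marks)) 0 t b f' p' ->
  forall T, t <= T -> halts_within machine w T b.
Proof.
move=> w0 r T tT; exists t; split=> //=.
have [qE _ _ _] := represents_exec r (represents_init w0).
by rewrite /halted /= qE; split=> //; case: (b).
Qed.

End Realize.

(* Writes all marks on the first cell, that is, zeroes the registers. *)
Definition clear (K : nat) : frag K :=
  @Frag K bool false (fun q g =>
    if q then (inr true, g, MoveL) else (inl true, (g.1, [ffun _ => true]), MoveR)).

Lemma runs_clear K w :
  runs (clear K) (fun i => (onth w i, no_marks K)) 0 2 true (tape K w (fun _ => 0)) 0.
Proof.
set f := fun i => _; set f' := tape _ _ _.
have f'E : upd f 0 ((f 0).1, [ffun _ => true]) = f'.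
  apply: functional_extensionality => i; rewrite /upd /f' /tape /f /=.
  by case: i => [|i]; congr pair; apply/ffunP => x; rewrite !ffunE.
apply: (@exec_step K (clear K) _ _ _ true ((f 0).1, [ffun _ => true]) MoveR 1) => //.
rewrite f'E -{2}(upd_id f' 1).
exact: (@exec_exit K (clear K) _ _ _ true (f' 1) MoveL).
Qed.

Lemma formula_polytime (phi : form) : exists (M : TM) (c d : nat),
  forall w, 0 < size w -> halts_within M w (c * (size w).+1 ^ d) (sem w phi [::]).
Proof.
set K := max_reg phi 0; pose F := seqf (clear K) (compile K phi 0).
(* The constant [2] pays for [clear]. *)
have [c [d cdP]] := polyb_add (polyb_const 2) (polyb_cost phi).
exists (machine F), c, d => w w0.
have v0 : valid w (fun _ => 0) by [].
have [t [s' [tB r _ _]]] := ends_compile w0 (leqnn K) v0.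
apply: (machine_halts w0 (runs_ite (runs_clear K w) _)); first exact: r.
by apply: leq_trans (cdP (size w)); rewrite leq_add2l.
Qed.

(** * A formula for well-coveredness *)

Definition Or phi psi := Not (And (Not phi) (Not psi)).
Definition Ex k phi := Not (Count k phi None).
Definition Eq x y := And (Not (Less x y)) (Not (Less y x)).
Definition Leq x y := Not (Less y x).
Fixpoint Any (F : nat -> form) (k : nat) : form :=
  if k is k'.+1 then Or (F k') (Any F k') else Less 0 0.

Section Semantics.
Variable w : seq bool.
Let N := size w.

Lemma sem_Not phi env : sem w (Not phi) env = ~~ sem w phi env.
Proof. by []. Qed.

Lemma sem_And phi psi env : sem w (And phi psi) env = sem w phi env && sem w psi env.
Proof. by []. Qed.

Lemma sem_Or phi psi env : sem w (Or phi psi) env = sem w phi env || sem w psi env.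
Proof. by rewrite /= negb_and !negbK. Qed.

Lemma sem_Eq x y env : sem w (Eq x y) env = (nth 0 env x == nth 0 env y).
Proof. by rewrite /= -!leqNgt eqn_leq andbC. Qed.

Lemma sem_Leq x y env : sem w (Leq x y) env = (nth 0 env x <= nth 0 env y).
Proof. by rewrite /= -leqNgt. Qed.

Lemma sem_Any F k env : sem w (Any F k) env = has (fun i => sem w (F i) env) (iota 0 k).
Proof.
elim: k => [|k IH]; first by rewrite /= ltnn.
by rewrite -addn1 iotaD has_cat [Any _ _]/= addn1 sem_Or IH /= orbF orbC.
Qed.

(** Saturation at [N] cannot affect a comparison with a value below [N]. *)
Lemma sem_Count k phi x env : nth 0 env x < N ->
  sem w (Count k phi (Some x)) env =
  (count_tuples N k.+1 (sem w phi) env == nth 0 env x).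
Proof. by rewrite /= -/N /value /=; set c := \sum_(_ < _) _; lia. Qed.

Lemma count_tuples_gt0 k (P : seq nat -> bool) env :
  reflect (exists ts, [/\ size ts = k, all (fun a => a < N) ts & P (ts ++ env)])
    (0 < count_tuples N k P env).
Proof.
elim: k env => [|k IH] env /=.
  by rewrite lt0b; apply: (iffP idP) => [Pe|[[|a ts] [] //]]; exists [::].
rewrite lt0n sum_nat_eq0 negb_forall; apply: (iffP existsP) => /=.
- move=> [a]; rewrite -lt0n => /IH[ts [sz lt Pt]].
  (* The outermost variable lies deepest in the environment, hence comes last in the tuple. *)
  exists (rcons ts (val a)); rewrite size_rcons sz all_rcons lt ltn_ord.
  by rewrite -cats1 -catA.
- move=> [ts []]; case/lastP: ts => // ts a; rewrite size_rcons all_rcons.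
  move=> [sz] /andP[aN lt]; rewrite -cats1 -catA => Pt.
  by exists (Ordinal aN); rewrite -lt0n; apply/IH; exists ts.
Qed.

Hypothesis N_gt0 : 0 < N.

(** As [N] is positive, saturation keeps a nonzero count nonzero. *)
Lemma sem_Ex k phi env :
  reflect (exists ts, [/\ size ts = k.+1, all (fun a => a < N) ts & sem w phi (ts ++ env)])
    (sem w (Ex k phi) env).
Proof.
have -> : sem w (Ex k phi) env = (0 < count_tuples N k.+1 (sem w phi) env).
  by rewrite /= -/N; set c := \sum_(_ < _) _; rewrite /value /=; lia.
exact: count_tuples_gt0.
Qed.

Lemma sem_Ex1 phi env :
  reflect (exists2 a, a < N & sem w phi (a :: env)) (sem w (Ex 0 phi) env).
Proof.
apply: (iffP (sem_Ex _ _ _)) => [[[|a [|b ts]] [] //= _]|[a aN Pa]].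
  by rewrite andbT => aN Pa; exists a.
by exists [:: a]; rewrite /= aN.
Qed.

Lemma sem_Ex2 phi env :
  reflect (exists a b, [/\ a < N, b < N & sem w phi (a :: b :: env)]) (sem w (Ex 1 phi) env).
Proof.
apply: (iffP (sem_Ex _ _ _)) => [[[|a [|b [|c ts]]] [] //= _]|[a [b [aN bN Pab]]]].
  by rewrite andbT => /andP[aN bN] Pab; exists a, b.
by exists [:: a; b]; rewrite /= aN bN.
Qed.
End Semantics.

(** * Counting sums and locating letters in a word *)

Lemma sum_ltn N m : \sum_(b < N) (b < m : nat) = minn m N.
Proof.
elim: N => [|N IH]; first by rewrite big_ord0 minn0.
by rewrite big_ord_recr /= IH; lia.
Qed.

Lemma sum_eqn N i : \sum_(b < N) (b == i :> nat : nat) = (i < N).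
Proof.
elim: N => [|N IH]; first by rewrite big_ord0.
by rewrite big_ord_recr /= IH; lia.
Qed.

Lemma onth_allpairs (S T U : Type) (f : S -> T -> U) s t i j x y :
  onth s i = Some x -> onth t j = Some y ->
  onth (allpairs f s t) (i * size t + j) = Some (f x y).
Proof.
move=> si tj; have jt : j < size t by rewrite -onthTE tj.
elim: s i si => [|x' s IH] [|i] //= si; rewrite onth_cat size_map.
  by case: si => ->; rewrite mul0n add0n jt onth_map tj.
by rewrite ifN; [rewrite mulSn -addnA addKn IH | rewrite mulSn; lia].
Qed.

Lemma sum_onth_take (s : seq bool) k : k <= size s ->
  \sum_(0 <= z < k) (onth s z != Some true : nat) = count negb (take k s).
Proof.
elim: s k => [|b s IH] [|k] //= ks; rewrite ?big_nil ?take0 //.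
by rewrite big_nat_recl //= IH //; case: b.
Qed.

(** Each block contains a single [false], at its end, so the letters preceded by exactly [u] letters
    [false] are those of block [u]. *)
Lemma block_nonempty (ps : seq nat) (u : nat) :
  let s := flatten (map unary ps) in
  (exists k, onth s k = Some true /\ count negb (take k s) = u) <-> 0 < nth 0 ps u.
Proof.
rewrite /=; elim: ps u => [|a ps IH] u /=.
  by rewrite nth_nil; split=> [[k []]|] //; rewrite onth0n.
set s := flatten _ in IH *; rewrite /unary cat_rcons.
have small k : k <= a -> take k (nseq a true ++ false :: s) = nseq k true.
  by move=> ka; rewrite take_cat size_nseq; case: ltngtP ka => // [ka|->] _;
    rewrite ?subnn ?take_nseq ?take0 ?cats0 //; apply: ltnW.
have big k : take (a.+1 + k) (nseq a true ++ false :: s) = nseq a true ++ false :: take k s.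
  by rewrite take_cat size_nseq ifN ?addSnnS ?addKn //; lia.
have onth_small k : k < a -> onth (nseq a true ++ false :: s) k = Some true.
  by move=> ka; rewrite onth_cat size_nseq ka onth_nseq ka.
have onth_big k : onth (nseq a true ++ false :: s) (a.+1 + k) = onth s k.
  by rewrite onth_cat size_nseq ifN ?addSnnS ?addKn //; lia.
have onth_a : onth (nseq a true ++ false :: s) a = Some false.
  by rewrite onth_cat size_nseq ltnn subnn.
split.
- move=> [k []]; case: (ltngtP k a) => [ka|ak|->]; last by rewrite onth_a.
  + by rewrite small ?(ltnW ka) // count_nseq /= => _ <-; apply: leq_ltn_trans ka.
  + rewrite -(subnKC ak) onth_big big count_cat count_nseq /= => sk <- /=.
    by apply/(IH _); exists (k - a.+1).
- case: u => [|u] /=; first by exists 0; rewrite onth_small // take0.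
  by move=> /(IH _) [k [sk <-]]; exists (a.+1 + k); rewrite onth_big big count_cat count_nseq.
Qed.

(** * Formulas that read the encoded graph and partition *)

Section Encoding.
Variables (r l n : nat) (e : rel 'I_n) (p : 'I_n -> 'I_(r + l)).
Let w := encode_instance e p.
Let N := size w.
Let blocks := flatten [seq unary (p v) | v <- enum 'I_n].
Let base := n.+1 + n * n.

Lemma size_unary k : size (unary k) = k.+1.
Proof. by rewrite size_rcons size_nseq. Qed.

Lemma size_encode : N = base + size blocks.
Proof.
by rewrite /N /w !size_cat size_unary size_allpairs !size_enum_ord addnA.
Qed.

Lemma ltn_size_encode : n < N.
Proof. by rewrite size_encode /base; lia. Qed.

Lemma size_encode_gt0 : 0 < N.
Proof. exact: leq_ltn_trans ltn_size_encode. Qed.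

Lemma onth_encode_unary z : z <= n -> onth w z = Some (z < n).
Proof.
move=> zn; rewrite /w /encode_instance onth_cat size_unary ltnS zn.
rewrite /unary -cats1 onth_cat size_nseq onth_nseq.
by case: ltnP zn => // nz zn; rewrite (_ : z - n = 0) //; lia.
Qed.

Lemma onth_encode_edge (i j : 'I_n) : onth w (n.+1 + (i * n + j)) = Some (e i j).
Proof.
rewrite /w /encode_instance onth_cat size_unary ifN; last by lia.
rewrite addKn onth_cat size_allpairs !size_enum_ord ifT.
  have enumE (k : 'I_n) : onth (enum 'I_n) k = Some k.
    by rewrite onthE (nth_map k) ?size_enum_ord // nth_ord_enum.
  by have := onth_allpairs e (enumE i) (enumE j); rewrite size_enum_ord.
by have := ltn_ord i; have := ltn_ord j; nia.
Qed.

Lemma onth_encode_blocks z : onth w (base + z) = onth blocks z.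
Proof.
rewrite /w /encode_instance onth_cat size_unary ifN; last by rewrite /base; lia.
rewrite /base -addnA addKn onth_cat size_allpairs !size_enum_ord ifN; last by lia.
by rewrite addKn.
Qed.

(** The word starts with [unary n], so [n] is the position of its first letter [false]. *)
Definition IsN x := And (Not (Letter x)) (Not (Ex 0 (And (Less 0 x.+1) (Not (Letter 0))))).

Lemma sem_IsN x env : sem w (IsN x) env = (nth 0 env x == n).
Proof.
rewrite sem_And 2!sem_Not [sem _ (Letter _) _]/=; set u := nth 0 env x.
apply/andP/eqP => [[ux /(sem_Ex1 size_encode_gt0) noz]|xn].
- case: (ltngtP u n) => // [un|nu]; first by rewrite onth_encode_unary ?un // ltnW in ux.
  case: noz => //; exists n; first exact: ltn_size_encode.
  by rewrite /= nu onth_encode_unary ?ltnn.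
- rewrite xn onth_encode_unary // ltnn; split=> //; apply/negP => /(sem_Ex1 size_encode_gt0)[z zN].
by rewrite sem_And sem_Not /= -/u xn => /andP[zn]; rewrite onth_encode_unary ?zn // ltnW.
Qed.

Definition Vertex x := Ex 0 (And (IsN 0) (Less x.+1 0)).

Lemma sem_Vertex x env : sem w (Vertex x) env = (nth 0 env x < n).
Proof.
apply/(sem_Ex1 size_encode_gt0)/idP => [[a aN]|xn].
  by rewrite sem_And sem_IsN /= => /andP[/eqP ->].
exists n; first exact: ltn_size_encode.
by rewrite sem_And sem_IsN /= eqxx.
Qed.

(* The pairs [(a, b)] with [a < i] and [b < n], those with [a = i] and
   [b < j], and those with [a = n] and [b <= n], number [i * n + j + n.+1]. *)
Definition Position x i j m :=
  Count 1 (Or (And (Less 1 i.+2) (Less 0 m.+2))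
          (Or (And (Eq 1 i.+2) (Less 0 j.+2)) (And (Eq 1 m.+2) (Leq 0 m.+2)))) (Some x).

(** Two vertices locate their matrix entry, while [v i = v j = n] locates [base], where the blocks
    start. In the latter case the pairs of the second kind are among those of the third, whence the
    [if]. *)
Lemma sem_Position x i j m env : let v := nth 0 env in
  v x < N -> v m = n -> (v i < n) && (v j <= n) || (v i == n) && (v j == n) ->
  sem w (Position x i j m) env = (v x == n.+1 + (v i * n + if v i == n then 0 else v j)).
Proof.
move=> v xN mn ij; rewrite sem_Count // -/N eq_sym; congr (_ == _).
pose t := if v i == n then 0 else v j.
transitivity (\sum_(a < N) (n * (a < v i) + t * (val a == v i) + n.+1 * (val a == n))).
  apply: eq_bigr => a _; rewrite /=.
  transitivity (\sum_(b < N) (b < n * (a < v i) + t * (val a == v i) + n.+1 * (val a == n) : nat)).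
    apply: eq_bigr => b _; congr nat_of_bool.
    rewrite /= -[nth 0 env i]/(v i) -[nth 0 env j]/(v j) -[nth 0 env m]/(v m) mn /t.
    move: ij; case: (ltngtP (val a) (v i)); case: (ltngtP (val a) n); case: eqP; lia.
  rewrite sum_ltn; apply/minn_idPl; have := ltn_size_encode.
  move: ij; rewrite /t; case: (ltngtP (val a) (v i)); case: (ltngtP (val a) n); case: eqP; lia.
rewrite !big_split /= -!big_distrr /= sum_ltn !sum_eqn.
have := ltn_size_encode; rewrite /t -/N; move: ij; case: eqP => [->|]; nia.
Qed.

(** Variables range over all positions, so adjacency is extended by [false] outside the vertices. *)
Definition adj (u v : nat) : bool :=
  [exists i : 'I_n, exists j : 'I_n, [&& val i == u, val j == v & e i j]].

Lemma adj_ord (i j : 'I_n) : adj i j = e i j.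
Proof.
apply/existsP/idP => [[i' /existsP[j' /and3P[/eqP/val_inj-> /eqP/val_inj-> //]]]|eij].
by exists i; apply/existsP; exists j; rewrite !eqxx.
Qed.

Lemma adj_lt u v : adj u v -> (u < n) && (v < n).
Proof. by move=> /existsP[i /existsP[j /and3P[/eqP<- /eqP<- _]]]; rewrite !ltn_ord. Qed.

Definition Adj x y :=
  Ex 0 (And (IsN 0) (And (And (Less x.+1 0) (Less y.+1 0))
    (Ex 0 (And (Position 0 x.+2 y.+2 1) (Letter 0))))).

Lemma sem_Adj x y env : sem w (Adj x y) env = adj (nth 0 env x) (nth 0 env y).
Proof.
set u := nth 0 env x; set v := nth 0 env y.
apply/(sem_Ex1 size_encode_gt0)/idP => [[m mN]|uv].
- rewrite sem_And sem_IsN 2!sem_And => /andP[/eqP mn /andP[/andP[un vn] uvk]].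
  rewrite /= in mn un vn; subst m; move: uvk.
  move=> /(sem_Ex1 size_encode_gt0)[k kN]; rewrite sem_And => /andP[].
  rewrite sem_Position //= -?/u -?/v ?un ?(ltnW vn) // ifN; last by lia.
  by move=> /eqP ->; rewrite (onth_encode_edge (Ordinal un) (Ordinal vn)) -adj_ord => /eqP[].
- have /andP[un vn] := adj_lt uv; exists n; first exact: ltn_size_encode.
  rewrite sem_And sem_IsN 2!sem_And.
  apply/and3P; split; [exact: eqxx | exact/andP |].
  have : onth w (n.+1 + (u * n + v)) = Some true.
    by rewrite (onth_encode_edge (Ordinal un) (Ordinal vn)) -adj_ord uv.
  move Ek: (n.+1 + _) => k kt.
  have kN : k < N by rewrite -onthTE kt.
  apply/(sem_Ex1 size_encode_gt0); exists k => //.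
  rewrite sem_And sem_Position //= -?/u -?/v ?un ?(ltnW vn) //.
  by rewrite ifN ?Ek ?eqxx ?kt //; lia.
Qed.

(* Vertex [u] lies outside part [0] iff its block starts with [true], i.e. iff
   some letter [true] of the blocks is preceded by exactly [u] letters [false]. *)
Definition InPart0 x :=
  And (Vertex x) (Not (Ex 0 (And (Letter 0) (Ex 1 (And (IsN 0)
    (And (And (Position 1 0 0 0) (Leq 1 2))
         (Count 0 (And (Leq 2 0) (And (Less 0 3) (Not (Letter 0)))) (Some x.+3)))))))).

(** Only positions from [base] to below [k] contribute, and a shift by [base] turns them into a
    prefix of [blocks]. *)
Lemma sum_block_ends k : k <= N ->
  \sum_(z < N) [&& ~~ (z < base), z < k & onth w z != Some true] =
  count negb (take (k - base) blocks).
Proof.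
move=> kN; rewrite -(big_mkord xpredT
  (fun z => [&& ~~ (z < base), z < k & onth w z != Some true] : nat)).
case: (leqP base k) => bk; last first.
  by rewrite (_ : k - base = 0) ?take0; [rewrite big1 // => z _ | ]; lia.
rewrite (big_cat_nat (leq0n k) kN) (big_cat_nat (leq0n base) bk) /=.
rewrite big_nat big1 ?add0n => [|z]; last by lia.
rewrite [X in _ + X]big_nat [X in _ + X]big1 ?addn0 => [|z]; last by lia.
rewrite -sum_onth_take; last by rewrite leq_subLR -size_encode.
rewrite -{1}[base]add0n big_addn big_nat [RHS]big_nat; apply: eq_bigr => z zk.
by rewrite -onth_encode_blocks [base + z]addnC; case: eqP => _; lia.
Qed.

(** [Position] taken at [n] and [n] supplies [base]; then [block_nonempty] reads off whether the
    part number is positive. *)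
Lemma sem_InPart0 x env :
  sem w (InPart0 x) env = [exists i : 'I_n, (val i == nth 0 env x) && (val (p i) == 0)].
Proof.
rewrite sem_And sem_Not sem_Vertex; set u := nth 0 env x.
have nthE (un : u < n) : nth 0 [seq val (p v) | v <- enum 'I_n] u = p (Ordinal un).
  by rewrite (nth_map (Ordinal un)) ?size_enum_ord // (nth_ord_enum _ (Ordinal un)).
have blocksE : blocks = flatten (map unary [seq val (p v) | v <- enum 'I_n]).
  by rewrite -map_comp.
have posE (un : u < n) : sem w (Ex 0 (And (Letter 0) (Ex 1 (And (IsN 0)
    (And (And (Position 1 0 0 0) (Leq 1 2))
         (Count 0 (And (Leq 2 0) (And (Less 0 3) (Not (Letter 0)))) (Some x.+3))))))) env
    = (0 < p (Ordinal un)).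
  have uN : u < N by apply: ltn_trans un ltn_size_encode.
  apply/(sem_Ex1 size_encode_gt0)/idP => [[k kN]|].
  - rewrite sem_And => /andP[kt /(sem_Ex2 size_encode_gt0)[m [b [mN bN]]]].
    rewrite sem_And sem_IsN 2!sem_And sem_Leq => /and3P[/eqP mn /andP[bE bk] cnt].
    move: bE cnt; rewrite /= in mn bk; subst m.
    rewrite sem_Position //= ?eqxx ?orbT // addn0 => /eqP bE.
    rewrite bE in bk *; rewrite -/base sum_block_ends ?(ltnW kN) // => /eqP cnt.
    rewrite -nthE; apply/block_nonempty; rewrite -blocksE.
    exists (k - base); rewrite -onth_encode_blocks subnKC //; split; first exact/eqP.
    by move: cnt; rewrite -/u -/N; lia.
  - rewrite -nthE => /block_nonempty; rewrite -blocksE => -[k [kt ku]].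
    move: kt; rewrite -onth_encode_blocks; move Ek': (base + k) => k' kt.
    have k'N : k' < N by rewrite -onthTE kt.
    have bN : base < N by lia.
    exists k' => //; rewrite sem_And; apply/andP; split; first exact/eqP.
    apply/(sem_Ex2 size_encode_gt0); exists n, base; split=> //; first exact: ltn_size_encode.
    rewrite sem_And sem_IsN 2!sem_And sem_Leq; apply/and3P; split; first exact: eqxx.
      rewrite sem_Position //= ?eqxx ?orbT // addn0 eqxx; lia.
    rewrite sem_Count //.
    have := sum_block_ends (ltnW k'N); rewrite -{2}Ek' addKn ku => cnt.
    exact/eqP.
case: (ltnP u n) => [un|nu]; last first.
  by apply/esym/existsP => -[i /andP[/eqP iu _]]; have := ltn_ord i; rewrite iu; lia.
rewrite andTb posE -eqn0Ngt; apply/idP/existsP => [pu|[i /andP[/eqP iu pi]]].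
  by exists (Ordinal un); rewrite eqxx.
by rewrite (_ : Ordinal un = i) //; apply: val_inj.
Qed.

(** * Maximal independent sets generated by their traces on the cliques *)

Hypothesis r_le1 : r <= 1.
Hypothesis e_simple : simple_graph e.
Hypothesis p_part : rl_partition e p.

Definition in_indep (u : nat) : bool := [exists i : 'I_n, (val i == u) && (p i < r)].

Definition InIndep x := if r == 0 then Less 0 0 else InPart0 x.

Lemma sem_InIndep x env : sem w (InIndep x) env = in_indep (nth 0 env x).
Proof.
rewrite /InIndep; case: (posnP r) => [r0|r_gt0].
  by rewrite /= ltnn; apply/esym/existsP => -[i]; rewrite {2}r0 ltn0 andbF.
by rewrite sem_InPart0; apply: eq_existsb => i; congr andb => /=; lia.
Qed.

Lemma in_indep_ord (i : 'I_n) : in_indep i = (p i < r).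
Proof.
apply/existsP/idP => [[j /andP[/eqP/val_inj-> //]]|pi]; by exists i; rewrite eqxx.
Qed.

(* The set determined by the trace [ts] of an independent set on the cliques;
   entries of [ts] that are not vertices are ignored. *)
Definition generated (ts : seq nat) (u : nat) : bool :=
  (u < n) && (has (pred1 u) ts || in_indep u && ~~ has (adj u) ts).

(** The trace occupies the [k] variables from index [t] on. *)
Definition Generated x t k :=
  And (Vertex x) (Or (Any (fun i => Eq x (t + i)) k)
    (And (InIndep x) (Not (Any (fun i => Adj x (t + i)) k)))).

Lemma sem_Generated x pre ts post :
  sem w (Generated x (size pre) (size ts)) (pre ++ ts ++ post) =
  generated ts (nth 0 (pre ++ ts ++ post) x).
Proof.
have anyE F P : (forall i, sem w (F i) (pre ++ ts ++ post) =
      P (nth 0 (pre ++ ts ++ post) (size pre + i))) ->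
    sem w (Any F (size ts)) (pre ++ ts ++ post) = has P ts.
  move=> FP; rewrite sem_Any (eq_has FP).
  rewrite -[in RHS](mkseq_nth 0 ts) has_map.
  apply: eq_in_has => i; rewrite mem_iota => /= it.
  by rewrite nth_cat ltnNge leq_addr /= addKn nth_cat it.
rewrite sem_And sem_Vertex sem_Or sem_And sem_InIndep sem_Not /generated.
set u := nth 0 _ x.
rewrite (anyE _ (pred1 u)) ?(anyE _ (adj u)) // => i; first exact: sem_Adj.
by rewrite sem_Eq eq_sym.
Qed.

Definition MaxIndep k :=
  And (Not (Ex 1 (And (Generated 0 2 k) (And (Generated 1 2 k) (Adj 0 1)))))
      (Not (Ex 0 (And (Vertex 0) (And (Not (Generated 0 1 k))
        (Not (Ex 0 (And (Generated 0 2 k) (Adj 0 1)))))))).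

Definition generated_set (ts : seq nat) : {set 'I_n} := [set v : 'I_n | generated ts v].

Lemma generated_lt ts u : generated ts u -> u < n.
Proof. by case/andP. Qed.

(** A vertex without neighbour in [A] could be added to [A]; conversely, any vertex outside a
    dominating [A] has a neighbour in it. This is the form that [MaxIndep] expresses. *)
Lemma maximal_independentP (A : {set 'I_n}) :
  reflect ((forall u v, u \in A -> v \in A -> ~~ e u v) /\
           (forall u, u \notin A -> exists2 v, v \in A & e v u))
    (maximal_independent e A).
Proof.
have [esym eirr] := e_simple.
have indP (B : {set 'I_n}) :
    reflect (forall u v, u \in B -> v \in B -> ~~ e u v) (independent e B).
  apply: (iffP forall_inP) => [H u v uB vB|H u uB]; first by have /forall_inP := H u uB; apply.
  by apply/forall_inP => v; apply: H.
apply: (iffP maxsetP) => [[/indP indA maxA]|[indA maxA]]; split=> //.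
- move=> u uA; apply/exists_inP; apply: contraT => /exists_inPn noe.
  have AU : u |: A = A.
    apply: maxA (subsetUr _ _); apply/indP => x y.
    rewrite !inE => /orP[/eqP->|xA] /orP[/eqP->|yA]; [exact: eirr| | exact: noe |exact: indA].
    by rewrite esym; apply: noe.
  by move: uA; rewrite -AU setU11.
- exact/indP.
- move=> B /indP indB AB; apply/eqP; rewrite eqEsubset AB andbT.
  apply/subsetP => u uB; apply: contraT => /maxA[v vA evu].
  by have := indB v u (subsetP AB v vA) uB; rewrite evu.
Qed.

Lemma sem_MaxIndep ts post :
  sem w (MaxIndep (size ts)) (ts ++ post) = maximal_independent e (generated_set ts).
Proof.
have nN := ltn_size_encode.
have semG2 a b x : sem w (Generated x 2 (size ts)) (a :: b :: ts ++ post) =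
    generated ts (nth 0 (a :: b :: ts ++ post) x).
  exact: (sem_Generated x [:: a; b] ts post).
have semG1 a x : sem w (Generated x 1 (size ts)) (a :: ts ++ post) =
    generated ts (nth 0 (a :: ts ++ post) x).
  exact: (sem_Generated x [:: a] ts post).
rewrite sem_And 2!sem_Not; apply/andP/maximal_independentP => -[ind dom]; split.
- move=> u v; rewrite !inE => gu gv; apply: contra ind => euv.
  apply/(sem_Ex2 size_encode_gt0); exists (val u), (val v); split.
  + exact: ltn_trans (ltn_ord u) nN.
  + exact: ltn_trans (ltn_ord v) nN.
  + by rewrite 2!sem_And !semG2 sem_Adj adj_ord gu gv.
- move=> u; rewrite inE => gu; apply/exists_inP; apply: contraR dom => /exists_inPn noe.
  apply/(sem_Ex1 size_encode_gt0); exists (val u); first exact: ltn_trans (ltn_ord u) nN.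
  rewrite 2!sem_And 2!sem_Not sem_Vertex semG1 gu [_ < n]ltn_ord 2!andTb.
  apply/negP => /(sem_Ex1 size_encode_gt0)[v _].
  rewrite sem_And semG2 sem_Adj => /andP[gv evu].
  have vn := generated_lt gv.
  by have := noe (Ordinal vn); rewrite inE -adj_ord => /(_ gv)/negP[]; exact: evu.
- apply/negP => /(sem_Ex2 size_encode_gt0)[u [v [_ _]]].
  rewrite 2!sem_And !semG2 sem_Adj => /and3P[gu gv euv].
  have un := generated_lt gu; have vn := generated_lt gv.
  by have := ind (Ordinal un) (Ordinal vn); rewrite !inE -adj_ord => /(_ gu gv)/negP[]; exact: euv.
- apply/negP => /(sem_Ex1 size_encode_gt0)[u _].
  rewrite 2!sem_And 2!sem_Not sem_Vertex semG1 => /and3P[un gu /negP[]].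
  have [|v gv evu] := dom (Ordinal un); first by rewrite inE.
  apply/(sem_Ex1 size_encode_gt0); exists (val v); first exact: ltn_trans (ltn_ord v) nN.
  rewrite inE in gv; rewrite -adj_ord in evu.
  by rewrite sem_And semG2 sem_Adj; apply/andP.
Qed.

(* Traces have at most [r + l] vertices, so [l.+1] entries suffice. *)
Definition WellCovered :=
  Ex 0 (Not (Ex l (And (MaxIndep l.+1) (Not (Count 0 (Generated 0 1 l.+1) (Some l.+1)))))).

Lemma count_generated ts : \sum_(a < N) generated ts a = #|generated_set ts|.
Proof.
have nN := ltn_size_encode.
rewrite -(big_mkord xpredT (fun a => generated ts a : nat)).
rewrite (big_cat_nat (leq0n n) (ltnW nN)) /= [X in _ + X]big_nat [X in _ + X]big1 ?addn0.
  rewrite big_mkord -sum1_card [RHS]big_mkcond /=; apply: eq_bigr => a _.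
  by rewrite inE; case: generated.
by move=> a; rewrite /generated; case: ltnP => //; lia.
Qed.

(** The tuple lists the trace [X] of [I] on the cliques; maximality recovers the rest of [I] from
    it. *)
Lemma maximal_independent_generated (I : {set 'I_n}) : maximal_independent e I ->
  exists ts, [/\ size ts = l.+1, all (fun a => a < N) ts & generated_set ts = I].
Proof.
have [esym eirr] := e_simple; have nN := ltn_size_encode.
move=> maxI; have [indI domI] := maximal_independentP _ maxI.
pose X := [set v in I | r <= p v].
have Xl : #|X| <= l.+1.
  (* Distinct vertices of [X] in one clique would be adjacent, against the independence of [I].
     Hence [X] has at most [r + l] vertices. *)
  have injp : {in X &, injective p}.
    move=> x y; rewrite !inE => /andP[xI rx] /andP[yI _] pxy.
    have := p_part (p x); rewrite ifN -?leqNgt // => /forall_inP/(_ x).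
    rewrite inE eqxx => /(_ isT)/forall_inP/(_ y); rewrite inE pxy eqxx => /(_ isT).
    by case: eqP => //= _ exy; have := indI x y xI yI; rewrite exy.
  rewrite -(card_in_imset injp) (leq_trans (max_card _)) // card_ord -add1n leq_add2r.
  exact: r_le1.
have nxp x y : p x < r -> p y < r -> ~~ e x y.
  move=> px py; have pxy : p y = p x by apply: val_inj => /=; lia.
  have := p_part (p x); rewrite px => /forall_inP/(_ x).
  by rewrite inE eqxx => /(_ isT)/forall_inP/(_ y); rewrite inE pxy eqxx; apply.
(* The padding [n] is a position of the word but not a vertex, so it generates nothing and has no
   neighbour. *)
exists ([seq val v | v <- enum X] ++ nseq (l.+1 - #|X|) n); split.
- by rewrite size_cat size_map -cardE size_nseq subnKC.
- rewrite all_cat all_nseq nN orbT andbT all_map; apply/allP => v _ /=.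
  exact: ltn_trans (ltn_ord v) nN.
apply/setP => v; rewrite inE /generated ltn_ord !has_cat !has_map !has_nseq /=.
have -> : (n == v) = false by have := ltn_ord v; lia.
have -> : adj v n = false.
  by apply/negbTE/negP => /adj_lt/andP[_]; rewrite ltnn.
rewrite !andbF !orbF in_indep_ord.
have -> : has (preim val (pred1 (val v))) (enum X) = (v \in X).
  apply/hasP/idP => [[y]|vX]; first by rewrite mem_enum => yX /eqP/val_inj <-.
  by exists v; rewrite ?mem_enum //=.
rewrite inE; case: (ltnP (p v) r) => pv; rewrite ?andbT ?andbF ?orbF //=.
apply/hasPn/idP => [noadj|vI y].
(* If [v] were not in [I], it would have a neighbour [y] in [I]: a clique vertex contradicts
   [noadj], a vertex of the independent part contradicts [nxp]. *)
- apply: contraT => /domI[y yI eyv].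
  have := noadj y; rewrite mem_enum inE yI /= adj_ord esym eyv.
  case: (leqP r (p y)) => [_ /(_ isT)//|py _].
  by have := nxp y v py pv; rewrite eyv.
- by rewrite mem_enum inE => /andP[yI _] /=; rewrite adj_ord; apply: indI.
Qed.

(** Every maximal independent set is generated by some tuple, so it has the common size [c];
    conversely, the size of any one of them serves as [c]. *)
Lemma sem_WellCovered : sem w WellCovered [::] <-> well_covered e.
Proof.
have nN := ltn_size_encode.
(* Sizes of vertex sets are positions of the word, so a variable can hold them without
   saturation. *)
have cardN (A : {set 'I_n}) : #|A| < N.
  by apply: leq_ltn_trans nN; rewrite -[n in X in _ <= X]card_ord max_card.
split.
- move=> /(sem_Ex1 size_encode_gt0)[c cN]; rewrite sem_Not => /negP all_c.
  suff main A : maximal_independent e A -> #|A| = c by move=> A B /main-> /main->.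
  move=> maxA; have [ts [sz lt gA]] := maximal_independent_generated maxA.
  apply/eqP; apply: contra_notT all_c => Ac.
  apply/(sem_Ex size_encode_gt0); exists ts; split=> //.
  rewrite sem_And sem_Not -sz sem_MaxIndep gA maxA andTb.
  (* Index [l.+1] skips the trace and reaches the outer variable [c]. *)
  have cE : nth 0 (ts ++ [:: c]) (size ts) = c by rewrite nth_cat ltnn subnn.
  rewrite sem_Count cE //.
  apply: contra Ac => /eqP <-; rewrite -gA -count_generated; apply/eqP.
  by apply: eq_bigr => a _; rewrite (sem_Generated 0 [:: val a]).
- move=> wc.
  have [A0 maxA0] : {A | maximal_independent e A}.
    by apply: ex_maxset; exists set0; apply/forall_inP => x; rewrite inE.
  apply/(sem_Ex1 size_encode_gt0); exists #|A0|; first exact: cardN.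
  rewrite sem_Not; apply/negP => /(sem_Ex size_encode_gt0)[ts [sz lt]].
  rewrite sem_And sem_Not -sz sem_MaxIndep => /andP[maxA /negP[]].
  have cE : nth 0 (ts ++ [:: #|A0|]) (size ts) = #|A0| by rewrite nth_cat ltnn subnn.
  rewrite sem_Count cE // -(wc _ _ maxA maxA0) -count_generated; apply/eqP.
  by apply: eq_bigr => a _; rewrite (sem_Generated 0 [:: val a]).
Qed.

End Encoding.

(** The formula, and with it the machine and its time bound, depends only on [r] and [l]; the
    encoding is nonempty even for [n = 0]. *)
Lemma wc_rlg_polytime_le1 r l : r <= 1 -> wc_rlg_polytime r l.
Proof.
move=> r1; have [M [c [d MP]]] := formula_polytime (WellCovered r l).
exists M, c, d => n e p e_simple p_part; exists (sem (encode_instance e p) (WellCovered r l) [::]).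
split; first exact/MP/size_encode_gt0.
exact: sem_WellCovered.
Qed.

Theorem theorem2 : forall l : nat, wc_rlg_polytime 0 l /\ wc_rlg_polytime 1 l.
Proof. by move=> l; split; apply: wc_rlg_polytime_le1. Qed.
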